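(* Let $n\ge 3$ be an integer, let $\mathcal A_1$ be an $N$-dimensional complex vector space, let $\Gamma:\mathcal A_1^{\times (n-1)}\to\mathcal A_1$ be a $\mathbb C$-multilinear map, and let $q_1:\mathcal A_1\times\mathcal A_1\to\mathbb C$ be a symmetric, non-degenerate bilinear form. Assume: (i) (invariance) for all $a_1,\dots,a_n\in\mathcal A_1$, $$q_1(\Gamma(a_1,\dots,a_{n-1}),a_n)=q_1(\Gamma(a_2,\dots,a_n),a_1)=q_1(a_1,\Gamma(a_2,\dots,a_n));$$ (ii) (general associativity) for all $a_1,\dots,a_{2n-3}\in\mathcal A_1$, $$\Gamma(\Gamma(a_1,\dots,a_{n-1}),a_n,\dots,a_{2n-3})=\Gamma(a_1,\Gamma(a_2,\dots,a_n),a_{n+1},\dots,a_{2n-3})=\cdots=\Gamma(a_1,\dots,a_{n-2},\Gamma(a_{n-1},\dots,a_{2n-3})).$$ Then there exists a $\mathbb Z_{n-2}$-graded, associative, metrised algebra $(\mathcal A,q)$ over $\mathbb C$, $$\mathcal A=\mathcal A_0\oplus\mathcal A_1\oplus\dots\oplus\mathcal A_{n-3},$$ whose degree-$1$ component is the given vector space $\mathcal A_1$, where $q$ is a non-degenerate symmetric bilinear form on $\mathcal A$ with $q|_{\mathcal A_1\times\mathcal A_1}=q_1$ and $q|_{\mathcal A_i\times\mathcal A_j}=0$ whenever $i+j\not\equiv 2 \pmod{n-2}$, and such that the map $\Gamma$ and the algebra multiplication are related by $$\Gamma(a_1,\dots,a_{n-1})=a_1\cdot a_2\cdots a_{n-1}\qquad\text{for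 all } a_1,\dots,a_{n-1}\in\mathcal A_1.$$
   Context: Algebras are over $\mathbb C$ and are not required to have a unit. For $m\ge1$, an algebra $\mathcal A=\bigoplus_{i=0}^{m-1}\mathcal A_i$ is $\mathbb Z_m$-graded if $\mathcal A_i\cdot\mathcal A_j\subseteq\mathcal A_{i+j \bmod m}$ (no sign conventions; it is not a super-grading). Indices of the components are read modulo $m=n-2$; in particular for $n=3$ there is a single component, $\mathcal A=\mathcal A_0=\mathcal A_1$. An algebra $\mathcal A$ with a non-degenerate symmetric bilinear form $q$ is called metrised if $q(a\cdot b,c)=q(a,b\cdot c)$ for all $a,b,c\in\mathcal A$. *)

(* Defs.v *)
From HB Require Import structures.
From mathcomp Require Import all_boot all_order all_algebra.
From mathcomp Require Export sesquilinear.
From mathcomp Require Export reals.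
From mathcomp Require Export complex.

Set Implicit Arguments.
Unset Strict Implicit.
Unset Printing Implicit Defensive.

Import GRing.Theory.
Local Open Scope ring_scope.

(* Operations of arity p take a finite function on 'I_p.  Arguments a_1, a_2, ...
   are given as a sequence a : nat -> V numbered from 0, so that a_{i+1} is a i;
   only finitely many entries of the sequence are ever read. *)
Section NaryOperations.
Variables (K : fieldType) (V : lmodType K) (p : nat).
Implicit Types (G : {ffun 'I_p -> V} -> V) (a : nat -> V).

Definition multilinear G : Prop :=
  forall (i : 'I_p) (v : {ffun 'I_p -> V}),
    linear (fun x : V => G [ffun j => if j == i then x else v j]).

(* G (a_{k+1}, ..., a_{k+p}) *)
Definition op_from G (k : nat) a : V := G [ffun j : 'I_p => a (k + j)%N].

(* G (a_1, ..., a_k, G (a_{k+1}, ..., a_{k+p}), a_{k+p+1}, ..., a_{2p-1}),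
   for k < p *)
Definition op_nested G (k : nat) a : V :=
  G [ffun i : 'I_p => if (i < k)%N then a i
                      else if i == k :> nat then op_from G k a
                      else a (i + p.-1)%N].

Definition generally_associative G : Prop :=
  forall a (k : nat), (k.+1 < p)%N -> op_nested G k a = op_nested G k.+1 a.

End NaryOperations.

(* For a symmetric form the one-sided condition is the two-sided one. *)
Definition form_nondegenerate (K : fieldType) (V : lmodType K)
    (q : {symmetric V}) : Prop :=
  forall x : V, (forall y : V, q x y = 0) -> x = 0.

(* q (G (a_1, ..., a_{n-1}), a_n) = q (G (a_2, ..., a_n), a_1) = ...;
   a_n is a (n - 1). *)
Definition form_invariant (K : fieldType) (V : lmodType K) (n : nat)
    (G : {ffun 'I_(n - 1) -> V} -> V) (q : {symmetric V}) : Prop :=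
  forall a : nat -> V,
    q (op_from G 0 a) (a (n - 1)%N) = q (op_from G 1 a) (a 0%N) /\
    q (op_from G 1 a) (a 0%N) = q (a 0%N) (op_from G 1 a).

(* Algebras need not be unital, so they are not MathComp algTypes: an algebra is
   a vector space A with a bilinear product mul. *)
Section Algebras.
Variables (K : fieldType) (A : lmodType K) (mul : {bilinear A -> A -> A}).

Definition direct_sum (m : nat) (A_ : 'I_m -> {pred A}) : Prop :=
  (forall i, submod_closed (A_ i)) /\
  forall x : A, exists! c : {ffun 'I_m -> A},
    (forall i, c i \in A_ i) /\ x = \sum_(i < m) c i.

Definition graded (m : nat) (A_ : 'I_m -> {pred A}) : Prop :=
  direct_sum A_ /\
  forall i j k : 'I_m, k = i + j %[mod m] ->
    forall x y : A, x \in A_ i -> y \in A_ j -> mul x y \in A_ k.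

Definition metrised (q : {symmetric A}) : Prop :=
  form_nondegenerate q /\ forall a b c : A, q (mul a b) c = q a (mul b c).

(* a_1 . a_2 ... a_{k+1}, bracketed to the left *)
Fixpoint product (a : nat -> A) (k : nat) : A :=
  if k is k'.+1 then mul (product a k') (a k) else a 0%N.

End Algebras.

(* Main.v *)
(* Evaluating words in A1 with Gamma, q1 gives a scalar <w> for every word w of
   length 2 mod n - 2, namely q1 (w_1 ... w_{l-1}, w_l); put <w> = 0 for the
   other lengths.  General associativity and invariance make <w> invariant under
   cyclic rotation, so T (u, v) = <uv> is a symmetric kernel on the semigroup of
   nonempty words with T (uv, w) = T (u, vw).  The radical of T on the semigroup
   algebra is therefore a homogeneous two-sided ideal, and A is the quotient,
   with the form induced by T.  A word u of length 1 mod n - 2 has the same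
   pairings as its value in A1, which identifies the component of degree 1.
   The empty word is excluded because for n = 3 a unit would enlarge A_1. *)
Require Import Defs.
From HB Require Import structures.
From mathcomp Require Import all_boot all_order all_algebra.
From mathcomp Require Import boolp functions.
Set Implicit Arguments.
Unset Strict Implicit.
Unset Printing Implicit Defensive.
Import GRing.Theory.
Local Open Scope ring_scope.

(** * The space spanned by a symmetric kernel, and its form *)

Section KernelSpan.
Variables (K : fieldType) (W : Type) (T : W -> W -> K).
Implicit Types (r s : seq (K * W)) (u v w : W) (g : W -> K).

(** The linear extension of [g] to formal combinations; repeated elements of [W] are allowed in the
    list. *)
Definition weighted r g : K := \sum_(t <- r) t.1 * g t.2.

Definition comb r : W -> K^o := fun w => weighted r (T^~ w).

Definition kernel_span : {pred W -> K^o} :=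
  fun f => `[< exists r, f = comb r >].

Lemma comb_in r : comb r \in kernel_span.
Proof. by apply/asboolP; exists r. Qed.

Lemma kernel_span_submod : submod_closed kernel_span.
Proof.
split=> [|a f g /asboolP[r ->] /asboolP[s ->]].
  by apply/asboolP; exists [::]; apply: funext => w;
    rewrite /comb /weighted big_nil.
apply/asboolP; exists ([seq (a * t.1, t.2) | t <- r] ++ s).
apply: funext => w; rewrite /comb /weighted big_cat big_map /=.
rewrite -[LHS]/(a * _ + _) mulr_sumr; congr (_ + _).
by apply: eq_bigr => t _; rewrite mulrA.
Qed.

HB.instance Definition _ :=
  GRing.isSubmodClosed.Build K (W -> K^o) kernel_span kernel_span_submod.

(* The quotient by the radical, realised as the image of r |-> T (r, -). *)
Record kalg := Kalg { kfun :> W -> K^o; _ : kfun \in kernel_span }.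

HB.instance Definition _ := [isSub for kfun].
HB.instance Definition _ := [Choice of kalg by <:].
HB.instance Definition _ := [SubChoice_isSubLmodule of kalg by <:].

Definition kcomb r : kalg := Kalg (comb_in r).

Implicit Types x y z : kalg.

Lemma kalgP (x y : kalg) : (forall w, x w = y w) <-> x = y.
Proof. by split=> [xy|->//]; apply: val_inj; apply: funext. Qed.

Lemma kalg_rep (x : kalg) : exists r, kcomb r = x.
Proof.
by case: x => f fP; have /asboolP[r rf] := fP; exists r; apply: val_inj.
Qed.

Definition rep (x : kalg) := projT1 (cid (kalg_rep x)).

Lemma repK x : kcomb (rep x) = x.
Proof. exact: projT2 (cid (kalg_rep x)). Qed.

Lemma kalgZ (a : K) (x y : kalg) w : (a *: x + y) w = a * x w + y w.
Proof. by []. Qed.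

Lemma kalg_sum (I : finType) (F : I -> kalg) w :
  (\sum_i F i) w = \sum_i F i w.
Proof.
by elim/big_rec2: _ => [//|i y1 y2 _ <-].
Qed.

Lemma weighted_lin r (a : K) g h :
  weighted r (fun w => a * g w + h w) = a * weighted r g + weighted r h.
Proof.
rewrite /weighted mulr_sumr -big_split; apply: eq_bigr => t _ /=.
by rewrite mulrDr mulrCA.
Qed.

Lemma weightedC r s (F : W -> W -> K) :
  weighted r (fun u => weighted s (F u)) =
  weighted s (fun v => weighted r (F^~ v)).
Proof.
rewrite /weighted; under eq_bigr do rewrite mulr_sumr.
rewrite exchange_big; apply: eq_bigr => t _; rewrite mulr_sumr.
by apply: eq_bigr => t' _; rewrite mulrCA.
Qed.

Lemma eq_weighted r g h : g =1 h -> weighted r g = weighted r h.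
Proof. by move=> gh; apply: eq_bigr => t _; rewrite gh. Qed.

Hypothesis TC : forall u v, T u v = T v u.

(** Both sides are the same double sum of [T] over [r] and [rep y]. The right side sees [r] only
    through [kcomb r], so the form below does not depend on the chosen representative. *)
Lemma weighted_kalg r (y : kalg) : weighted r y = weighted (rep y) (kcomb r).
Proof.
rewrite -{1}(repK y) weightedC.
by apply: eq_weighted => v; apply: eq_weighted => u; rewrite TC.
Qed.

Definition kform (x y : kalg) : K := weighted (rep x) y.

Lemma kform_rep r y : kform (kcomb r) y = weighted r y.
Proof. by rewrite /kform !(weighted_kalg _ y) repK. Qed.

Lemma kform_sym x y : kform x y = (-1) ^+ false * idfun (kform y x).
Proof. by rewrite mul1r /kform weighted_kalg repK. Qed.

Lemma kform_bilinear : bilinear_for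
  (GRing.Scale.Law.clone _ _ *%R _) (GRing.Scale.Law.clone _ _ *%R _) kform.
Proof.
have linr z : GRing.linear_for *%R (kform z).
  by move=> a x y; rewrite -weighted_lin.
split=> // z a x y.
by have := linr z a x y; rewrite ![kform z _]kform_sym !mul1r.
Qed.

HB.instance Definition _ := bilinear_isBilinear.Build K kalg kalg K
  _ _ kform kform_bilinear.
HB.instance Definition _ :=
  isHermitianSesquilinear.Build K kalg false idfun kform kform_sym.

Definition delta w : kalg := kcomb [:: (1, w)].

Lemma deltaE w v : delta w v = T w v.
Proof. by rewrite /= /comb /weighted big_seq1 mul1r. Qed.

Lemma kform_delta w x : kform (delta w) x = x w.
Proof. by rewrite kform_rep /weighted big_seq1 mul1r. Qed.

(** Pairing with [delta w] is evaluation at [w], and an element is determined by its values. *)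
Lemma kform_nondeg : form_nondegenerate kform.
Proof.
move=> x x0; apply/kalgP => w.
by rewrite -kform_delta kform_sym mul1r /= x0.
Qed.

(** * The associative product *)

Variable mulW : W -> W -> W.
Hypothesis mulWA : associative mulW.
Hypothesis TA : forall u v w, T (mulW u v) w = T u (mulW v w).

Definition kmul x y : kalg :=
  kcomb [seq (t.1 * t'.1, mulW t.2 t'.2) | t <- rep x, t' <- rep y].

(** Rotating [T (uv, w)] to [T (v, wu)] leaves [y] present only as a function; [kmulEr] does the
    same for [x]. Together they free the product from the choice of representatives and give
    linearity in each argument. *)
Lemma kmulEl x y w : kmul x y w = weighted (rep x) (fun u => y (mulW w u)).
Proof.
rewrite /= /comb /weighted big_allpairs_dep; apply: eq_bigr => t _ /=.
rewrite -{2}(repK y) /= /comb /weighted mulr_sumr; apply: eq_bigr => t' _ /=.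
by rewrite TC -TA TC mulrA.
Qed.

Lemma kmulEr x y w : kmul x y w = weighted (rep y) (fun v => x (mulW v w)).
Proof.
rewrite kmulEl -{1}(repK y) -{2}(repK x) weightedC.
by apply: eq_weighted => v; apply: eq_weighted => u; rewrite -TA TC.
Qed.

Lemma kmul_rep r y w : kmul (kcomb r) y w = weighted r (fun u => y (mulW w u)).
Proof.
rewrite kmulEr -{2}(repK y) weightedC.
by apply: eq_weighted => v; apply: eq_weighted => u; rewrite TC TA.
Qed.

Lemma kmul_delta u v : kmul (delta u) (delta v) = delta (mulW u v).
Proof.
apply/kalgP => w; rewrite kmul_rep /weighted big_seq1 !deltaE mul1r.
by rewrite TC TA TC.
Qed.

Lemma kmul_bilinear : bilinear_for
  (GRing.Scale.Law.clone _ _ *:%R _) (GRing.Scale.Law.clone _ _ *:%R _) kmul.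
Proof.
split=> z a x y; apply/kalgP => w; rewrite kalgZ.
  by rewrite !kmulEr -weighted_lin.
by rewrite !kmulEl -weighted_lin.
Qed.

HB.instance Definition _ := bilinear_isBilinear.Build K kalg kalg kalg
  _ _ kmul kmul_bilinear.

(** Expanding only the outer factors gives, on both sides, a double sum over [rep x] and [rep z] of
    the values of [y], at [v(wu)] and at [(vw)u]. *)
Lemma kmulA : associative kmul.
Proof.
move=> x y z; apply/kalgP => w; rewrite kmulEl kmulEr.
under eq_weighted do rewrite kmulEr.
rewrite weightedC; apply: eq_weighted => v; rewrite kmulEl.
by apply: eq_weighted => u; rewrite mulWA.
Qed.

Lemma kmul_metrised : metrised kmul kform.
Proof.
split=> [|x y z]; first exact: kform_nondeg.
rewrite /= kform_sym mul1r /kform /= (eq_weighted _ (kmulEl x y)).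
by rewrite weightedC; apply: eq_weighted => u; rewrite -kmulEr.
Qed.

(** * The grading by degree modulo [m] *)

Variables (m e : nat) (d : W -> nat).
Hypothesis m_gt0 : (0 < m)%N.
Hypothesis dM : forall u v, d (mulW u v) = (d u + d v)%N.
Hypothesis Td : forall u v, d u + d v <> e %[mod m] -> T u v = 0.

(* Nondegeneracy lets the pairings of x detect its degree. *)
Definition component (k : 'I_m) : {pred kalg} := fun x =>
  `[< forall w, d w + k <> e %[mod m] -> x w = 0 >].

Definition homogeneous_part k r := [seq t <- r | d t.2 == k %[mod m]].

(** A nonzero [T t w] forces the degrees of [t] and [w] to add up to [e], so at a given [w] the
    filter either drops only vanishing terms or keeps only vanishing ones. *)
Lemma homogeneous_partE k r w :
  kcomb (homogeneous_part k r) w =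
  if d w + k == e %[mod m] then kcomb r w else 0.
Proof.
rewrite /= /comb /weighted big_filter.
have dk t : T t w != 0 -> (d w + k == e %[mod m]) = (d t == k %[mod m]).
  move=> Tn0; have -> : e = d w + d t %[mod m].
    by apply/esym/eqP; apply: contraR Tn0 => /eqP; rewrite addnC => /Td ->.
  by rewrite eqn_modDl eq_sym.
rewrite big_mkcond; case: ifP => dw.
  apply: eq_bigr => t _; case: eqP => // /eqP dt.
  by case: (eqVneq (T t.2 w) 0) => [->|/dk]; rewrite ?mulr0 // dw (negPf dt).
rewrite big1 // => t _; case: ifP => // dt.
by case: (eqVneq (T t.2 w) 0) => [->|/dk]; rewrite ?mulr0 // dw dt.
Qed.

Lemma homogeneous_part_in (k : 'I_m) r :
  kcomb (homogeneous_part k r) \in component k.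
Proof. by apply/asboolP => w /eqP dw; rewrite homogeneous_partE (negPf dw). Qed.

Lemma component_rep (k : 'I_m) x :
  x \in component k -> kcomb (homogeneous_part k (rep x)) = x.
Proof.
move=> /asboolP xk; apply/kalgP => w; rewrite homogeneous_partE repK.
by case: eqP => // /xk ->.
Qed.

Lemma complementary_degree w : exists k : 'I_m,
  forall k' : 'I_m, (d w + k' == e %[mod m]) = (k' == k).
Proof.
(* The term [d w * m.-1] plays the part of [- d w] modulo [m]. *)
have lt_k : ((e + d w * m.-1) %% m < m)%N by rewrite ltn_mod.
exists (Ordinal lt_k) => k'.
have -> : e = d w + Ordinal lt_k %[mod m].
  by rewrite /= modnDmr addnCA -mulnS prednK // addnC modnMDl.
by rewrite eqn_modDl !modn_small.
Qed.

(** Evaluation at [w] sees exactly one component, that of complementary degree; existence and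
    uniqueness are both checked at each [w]. *)
Lemma component_direct_sum : direct_sum component.
Proof.
split=> [k|x].
  split=> [|a x y /asboolP xk /asboolP yk]; apply/asboolP => // w dw.
  by rewrite kalgZ xk // yk // mulr0 addr0.
exists [ffun k : 'I_m => kcomb (homogeneous_part k (rep x))]; split.
  split=> [k|]; first by rewrite ffunE; apply: homogeneous_part_in.
  apply/kalgP => w; have [k dk] := complementary_degree w.
  rewrite kalg_sum (bigD1 k) //= big1 => [|k' k'k]; rewrite ffunE.
    by rewrite homogeneous_partE dk eqxx repK addr0.
  by rewrite homogeneous_partE dk (negPf k'k).
move=> c [ck ->]; apply/ffunP => k; rewrite ffunE; apply/kalgP => w.
rewrite homogeneous_partE repK; have [k' dk] := complementary_degree w.
have c0 i : i != k' -> c i w = 0.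
  by move=> ik; have /asboolP := ck i; apply; apply/eqP; rewrite dk.
rewrite kalg_sum (bigD1 k') //= big1 ?addr0; last by move=> i /c0.
by rewrite dk; case: eqP => [->//|/eqP/c0 ->].
Qed.

Lemma kmul_graded : graded kmul component.
Proof.
split=> [|i j k kij x y xi yj]; first exact: component_direct_sum.
apply/asboolP => w dw; rewrite -(component_rep xi) kmul_rep.
rewrite /weighted big_filter big1 // => t /eqP dt.
have /asboolP -> := yj; first by rewrite mulr0.
move=> dwt; apply: dw; rewrite -modnDmr kij modnDmr -dwt dM.
by rewrite -addnA -[in RHS]modnDmr -[in RHS](modnDml _ j) dt modnDml modnDmr.
Qed.

Lemma kform_component (i j : 'I_m) x y : i + j <> e %[mod m] ->
  x \in component i -> y \in component j -> kform x y = 0.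
Proof.
move=> ij xi /asboolP yj; rewrite -(component_rep xi) kform_rep.
rewrite /weighted big_filter big1 // => t /eqP dt.
by rewrite yj ?mulr0 // -modnDml dt modnDml.
Qed.

Lemma delta_component w (k : 'I_m) :
  k = d w %[mod m] -> delta w \in component k.
Proof.
move=> kw; apply/asboolP => v dv; rewrite deltaE; apply: Td => dwv.
by apply: dv; rewrite addnC -modnDml kw modnDml.
Qed.

Lemma component_span (k : 'I_m) x : x \in component k ->
  exists2 r : seq (K * W), all (fun t => d t.2 == k %[mod m]) r &
    x = \sum_(t <- r) t.1 *: delta t.2.
Proof.
move=> xk; exists (homogeneous_part k (rep x)).
  exact: filter_all.
rewrite -[LHS](component_rep xk); move: (homogeneous_part _ _) => r.
apply/kalgP => w; elim: r => [|t r IHr].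
  by rewrite big_nil /= /comb /weighted big_nil.
by rewrite big_cons kalgZ -IHr deltaE /= /comb /weighted big_cons.
Qed.

(** An interface that hides the function model: only the generators and their pairings remain
    visible. *)
Theorem invariant_kernel_algebra :
  exists (A : lmodType K) (mul : {bilinear A -> A -> A})
         (A_ : 'I_m -> {pred A}) (q : {symmetric A}) (gen : W -> A),
    [/\ associative mul, graded mul A_ & metrised mul q] /\
    [/\ forall u v, mul (gen u) (gen v) = gen (mulW u v),
        forall u v, q (gen u) (gen v) = T u v,
        forall x : A, (forall w, q (gen w) x = 0) -> x = 0,
        forall (i j : 'I_m) (x y : A), i + j <> e %[mod m] ->
          x \in A_ i -> y \in A_ j -> q x y = 0 &
        forall (k : 'I_m), (forall w, k = d w %[mod m] -> gen w \in A_ k) /\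
          forall x : A, x \in A_ k -> exists2 r : seq (K * W),
            all (fun t => d t.2 == k %[mod m]) r &
            x = \sum_(t <- r) t.1 *: gen t.2].
Proof.
exists kalg, kmul, component, kform, delta; split; split.
- exact: kmulA.
- exact: kmul_graded.
- exact: kmul_metrised.
- exact: kmul_delta.
- by move=> u v; rewrite /= kform_delta deltaE.
- by move=> x x0; apply/kalgP => w; rewrite -kform_delta x0.
- exact: kform_component.
- move=> k; split; first by move=> w; apply: delta_component.
  exact: component_span.
Qed.

End KernelSpan.

(** * Iterated evaluation of an operation of arity [m.+1] *)

Section Contraction.
Variables (K : fieldType) (V : lmodType K) (m : nat).
Variable G : {ffun 'I_m.+1 -> V} -> V.
Implicit Types (a b : V) (s t : seq V) (x y : nat -> V).

Definition scons a x : nat -> V := fun i => if i is j.+1 then x j else a.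

(* Entry 0 of [iter k contract x] is the left-bracketed value of
   x 0, ..., x (k * m). *)
Definition contract x : nat -> V :=
  scons (op_from G 0 x) (fun i => x (i.+1 + m)%N).

Lemma iter_contractS k x i : iter k contract x i.+1 = x (i.+1 + k * m)%N.
Proof.
elim: k i => [|k IHk] i; first by rewrite addn0.
by rewrite iterS /= addSn IHk mulSn addnA.
Qed.

Lemma eq_op_from k x y :
  (forall i, (i <= m)%N -> x (k + i)%N = y (k + i)%N) ->
  op_from G k x = op_from G k y.
Proof. by move=> xy; congr G; apply/ffunP => j; rewrite !ffunE xy // -ltnS. Qed.

Lemma eq_iter_contract k x y :
  (forall i, (i <= k * m)%N -> x i = y i) ->
  iter k contract x 0%N = iter k contract y 0%N.
Proof.
elim: k x y => [|k IHk] x y xy; first exact: xy.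
rewrite !iterSr; apply: IHk => -[_|i lt_ik] /=.
  by apply: eq_op_from => i le_im; apply: xy;
    rewrite (leq_trans le_im) ?leq_addr.
by apply: xy; rewrite mulSn addnC leq_add2l.
Qed.

Hypothesis G_lin : multilinear G.

(** Each contraction puts its value back in front, so the first letter enters linearly at every
    stage. *)
Lemma iter_contract_linear k x (c : K) a b :
  iter k contract (scons (c *: a + b) x) 0%N =
  c *: iter k contract (scons a x) 0%N + iter k contract (scons b x) 0%N.
Proof.
elim: k x a b => [//|k IHk] x a b; rewrite !iterSr.
have contract_scons a' : contract (scons a' x) =
    scons (op_from G 0 (scons a' x)) (fun i => x (i + m)%N).
  by apply: funext; case.
have op_fromE a' : op_from G 0 (scons a' x) =
    G [ffun j => if j == ord0 then a' else [ffun j : 'I_m.+1 => x j.-1] j].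
  by congr G; apply/ffunP => -[[|j] ltj]; rewrite !ffunE.
by rewrite !contract_scons !op_fromE G_lin IHk.
Qed.

(** * Cyclic invariance of the scalar attached to a word *)

Variable q : {symmetric V}.
Hypothesis G_inv : forall x,
  q (op_from G 0 x) (x m.+1) = q (op_from G 1 x) (x 0%N).
Hypothesis G_assoc : forall x, op_nested G 0 x = op_nested G 1 x.
Hypothesis m_gt0 : (0 < m)%N.

Lemma form_sym a b : q a b = q b a.
Proof. by rewrite [LHS]hermC /= expr0 mul1r. Qed.

Definition contract1 x : nat -> V :=
  scons (x 0%N) (scons (op_from G 1 x) (fun i => x (i.+2 + m)%N)).

Lemma contract_contract1 x : contract (contract x) = contract (contract1 x).
Proof.
apply: funext => -[|i] /=.
  transitivity (op_nested G 0 x); last rewrite G_assoc; apply: (congr1 G).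
    by apply/ffunP => -[[|j] ltj]; rewrite !ffunE //= addnS.
  by apply/ffunP => -[[|[|j]] ltj]; rewrite !ffunE //= addnS.
(* Positivity of [m] ensures that the tail reads [contract1 x] only from index 2 on, past the
   contracted entry. *)
have : (0 < i + m)%N by rewrite addn_gt0 m_gt0 orbT.
by case: (i + m)%N.
Qed.

(** Symmetry of [q] settles [k = 0] and invariance [k = 1]. Beyond that, associativity shifts the
    first contraction one place right, off the first letter, and induction applies to the shorter
    word [contract1 x]. *)
Lemma iter_contract_cyclic k x :
  q (iter k contract x 0%N) (x (k * m).+1) =
  q (iter k contract (x \o S) 0%N) (x 0%N).
Proof.
elim: k x => [|[|k] IHk] x; first exact: form_sym.
  rewrite mul1n G_inv; congr (q _ _).
rewrite 2!iterSr contract_contract1 -iterSr.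
have -> : x (k.+2 * m).+1 = contract1 x (k.+1 * m).+1.
  have : (0 < k.+1 * m)%N by rewrite muln_gt0.
  by rewrite [(k.+2 * m)%N]mulSn addnC /=; case: (k.+1 * m)%N.
by rewrite IHk [in RHS]iterSr; congr (q (iter _ _ _ _) _).
Qed.

(* Only used for words of at least two letters; the value at shorter ones is
   junk. *)
Definition cyclic_form s : K :=
  if size s == 2 %[mod m]
  then q (iter ((size s - 2) %/ m) contract (nth 0 s) 0%N) (nth 0 s (size s).-1)
  else 0.

Lemma cyclic_formE k s : size s = (k * m).+2 ->
  cyclic_form s = q (iter k contract (nth 0 s) 0%N) (nth 0 s (k * m).+1).
Proof.
by move=> ss; rewrite /cyclic_form ss -addn2 modnMDl eqxx addnK mulnK // addn2.
Qed.

Lemma cyclic_form0 s : size s <> 2 %[mod m] -> cyclic_form s = 0.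
Proof. by move/eqP/negPf; rewrite /cyclic_form => ->. Qed.

(** The lower bound matters for [m] equal to 1 or 2, where lengths below 2 can be congruent to 2. *)
Lemma size_mod2P s : (1 < size s)%N ->
  size s <> 2 %[mod m] \/ exists k, size s = (k * m).+2.
Proof.
move=> s_gt1; case: (eqVneq (size s %% m)%N (2 %% m)%N) => [/eqP s2|/eqP s2].
  2: by left.
right; exists ((size s - 2) %/ m)%N.
by rewrite divnK -?eqn_mod_dvd // -addn2 subnK.
Qed.

Lemma cyclic_form_rot1 a s : cyclic_form (a :: s) = cyclic_form (rcons s a).
Proof.
case: s => [//|b s]; have [s2|[k ks]] := @size_mod2P (a :: b :: s) isT.
  by rewrite !cyclic_form0 // size_rcons.
have sk : size (b :: s) = (k * m).+1 by case: ks => /= ->.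
rewrite !(@cyclic_formE k) ?size_rcons ?sk // iter_contract_cyclic.
rewrite -[in RHS]sk nth_rcons ltnn eqxx; congr (q _ _).
by apply: eq_iter_contract => i le_ik; rewrite nth_rcons sk ltnS le_ik.
Qed.

Lemma cyclic_form_rot s t : cyclic_form (s ++ t) = cyclic_form (t ++ s).
Proof.
elim: s t => [|a s IHs] t; first by rewrite cats0.
by rewrite cat_cons cyclic_form_rot1 -cats1 -catA IHs -catA.
Qed.

(** Evaluation is bracketed to the left, so the first [k] contractions compute the value of the
    prefix. The letter [b] keeps the last entry, paired by [q], outside the prefix. *)
Lemma cyclic_form_contract k s b t : size s = (k * m).+1 ->
  cyclic_form (s ++ b :: t) =
  cyclic_form (iter k contract (nth 0 s) 0%N :: b :: t).
Proof.
set a := iter _ _ _ _ => sk.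
have size_st : size (s ++ b :: t) = (k * m + size (a :: b :: t))%N.
  by rewrite size_cat sk addSnnS.
have nth_st i : nth 0 (s ++ b :: t) (i.+1 + k * m) = nth 0 (b :: t) i.
  by rewrite addSnnS -sk nth_cat ltnNge leq_addl /= addnK.
have [t2|[l lt]] := @size_mod2P (a :: b :: t) isT.
  by rewrite !cyclic_form0 // size_st modnMDl.
rewrite (cyclic_formE lt) (@cyclic_formE (l + k)); last first.
  by rewrite size_st lt mulnDl addnC.
congr (q _ _); last by rewrite mulnDl -addSn nth_st.
rewrite iterD; congr (iter l contract _ 0%N); apply: funext => -[|i].
  by apply: eq_iter_contract => i le_ik; rewrite nth_cat sk ltnS le_ik.
by rewrite iter_contractS nth_st.
Qed.

(** * The kernel on the semigroup of words *)

(* A word is nonempty: first letter, remaining letters. *)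
Local Notation word := (V * seq V)%type.
Implicit Types u v w : word.

Definition letters u : seq V := u.1 :: u.2.
Definition concat u v : word := (u.1, u.2 ++ letters v).
Definition word_form u v : K := cyclic_form (letters u ++ letters v).

Lemma letters_concat u v : letters (concat u v) = letters u ++ letters v.
Proof. by []. Qed.

Lemma concatA : associative concat.
Proof. by move=> u v w; rewrite /concat /= -catA. Qed.

Lemma word_formC u v : word_form u v = word_form v u.
Proof. exact: cyclic_form_rot. Qed.

Lemma word_formA u v w : word_form (concat u v) w = word_form u (concat v w).
Proof. by rewrite /word_form !letters_concat catA. Qed.

Lemma word_form0 u v :
  size (letters u) + size (letters v) <> 2 %[mod m] -> word_form u v = 0.
Proof. by rewrite -size_cat; apply: cyclic_form0. Qed.

Lemma word_form_linear (c : K) a b v :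
  word_form (c *: a + b, [::]) v =
  c * word_form (a, [::]) v + word_form (b, [::]) v.
Proof.
rewrite /word_form /=.
have [t2|[k kt]] := @size_mod2P (a :: letters v) isT.
  by rewrite !cyclic_form0 // mulr0 addr0.
have sconsE a' : nth 0 (a' :: letters v) = scons a' (nth 0 (letters v)).
  by apply: funext; case.
rewrite !(@cyclic_formE k) // !sconsE iter_contract_linear /=.
by rewrite -linearPl.
Qed.

Lemma word_form_letter a b : word_form (a, [::]) (b, [::]) = q a b.
Proof. exact: (@cyclic_formE 0). Qed.

Lemma word_form_contract k u v : size (letters u) = (k * m).+1 ->
  word_form u v = word_form (iter k contract (nth 0 (letters u)) 0%N, [::]) v.
Proof. by move=> uk; rewrite /word_form (cyclic_form_contract _ _ uk). Qed.

End Contraction.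

(** * The algebra generated by words, graded by length *)

Theorem enveloping_algebra (K : fieldType) (V : lmodType K) (m : nat)
    (G : {ffun 'I_m.+1 -> V} -> V) (q1 : {symmetric V}) :
  (0 < m)%N -> multilinear G -> form_nondegenerate q1 ->
  (forall a, q1 (op_from G 0 a) (a m.+1) = q1 (op_from G 1 a) (a 0%N)) ->
  (forall a, op_nested G 0 a = op_nested G 1 a) ->
  exists (A : lmodType K) (mul : {bilinear A -> A -> A})
         (A_ : 'I_m -> {pred A}) (q : {symmetric A})
         (iota : {linear V -> A}),
    (associative mul /\ graded mul A_ /\ metrised mul q) /\
    (injective iota /\
     forall i : 'I_m, i = 1 %[mod m] ->
       forall x : A, x \in A_ i <-> exists a : V, x = iota a) /\
    (forall a b : V, q (iota a) (iota b) = q1 a b) /\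
    (forall i j : 'I_m, i + j <> 2 %[mod m] ->
       forall x y : A, x \in A_ i -> y \in A_ j -> q x y = 0) /\
    (forall a : nat -> V,
       iota (op_from G 0 a) = product mul (fun i => iota (a i)) m).
Proof.
move=> m_gt0 G_lin q1_nondeg G_inv G_assoc.
have [A [mul [A_ [q [gen [[mulA A_graded q_metrised]
    [genM q_gen gen_nondeg q_orth A_gen]]]]]]] :=
  invariant_kernel_algebra (word_formC G_inv G_assoc m_gt0) (@concatA _ V)
    (@word_formA _ _ _ G q1) m_gt0 (d := fun u => size (letters u))
    (fun u v => size_cat (letters u) (letters v)) (@word_form0 _ _ _ G q1).
(* Equalities in [A] are tested against generators, which turns them into identities between word
   forms. *)
have gen_eq x y : (forall w, q (gen w) x = q (gen w) y) -> x = y.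
  move=> xy; apply/eqP; rewrite -subr_eq0; apply/eqP/gen_nondeg => w.
  by rewrite linearBr /= xy subrr.
have gen_contract k u : size (letters u) = (k * m).+1 ->
    gen u = gen (iter k (contract G) (nth 0 (letters u)) 0%N, [::]).
  move=> uk; apply: gen_eq => w; rewrite !q_gen.
  rewrite ![word_form _ _ w _]word_formC //.
  exact: word_form_contract.
pose iota a := gen (a, [::]).
have iota_linear : linear iota.
  move=> c a b; apply: gen_eq => w; rewrite linearDr linearZr_LR /= !q_gen.
  by rewrite ![word_form _ _ w _]word_formC // word_form_linear.
pose iotaL : {linear V -> A} :=
  HB.pack iota (GRing.isLinear.Build K V A *:%R iota iota_linear).
have q_iota a b : q (iota a) (iota b) = q1 a b.
  by rewrite q_gen word_form_letter.
exists A, mul, A_, q, iotaL; split; [by []|split; [split|split; [by []|split]]].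
- move=> a b ab; apply/eqP; rewrite -subr_eq0; apply/eqP/q1_nondeg => c.
  by rewrite linearBl /= -!q_iota (ab : iota a = iota b) subrr.
- move=> i i1 x; have [A_gen_in A_gen_span] := A_gen i; split=> [xi|[a ->]].
    (* The spanning words have length 1 modulo [m], so each generator equals that of a single
       letter. *)
    have [r r1 ->] := A_gen_span x xi; elim: r r1 => [_|[c u] r IHr].
      by exists 0; rewrite big_nil linear0.
    case/andP=> u1 /IHr[b Eb].
    have [k uk] : exists k, size (letters u) = (k * m).+1.
      exists (size u.2 %/ m)%N; rewrite divnK // -[size u.2]subn0.
      by rewrite -eqn_mod_dvd // -(eqn_modDl 1) !add1n (eqP u1) i1.
    exists (c *: iter k (contract G) (nth 0 (letters u)) 0%N + b).
    by rewrite big_cons Eb linearP /= (gen_contract _ _ uk).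
  exact: A_gen_in.
- by move=> i j ij x y; apply: q_orth.
move=> a; have product_gen k :
    product mul (fun i => iotaL (a i)) k = gen (a 0%N, map a (seq.iota 1 k)).
  elim: k => [//|k IHk].
  by rewrite -[k.+1 in RHS]addn1 iotaD map_cat add1n /= IHk genM.
(* A word of [m.+1] letters takes exactly one contraction, a single application of [G]. *)
rewrite product_gen (gen_contract 1%N) /= ?size_map ?size_iota ?mul1n //.
congr (gen (_, _)); apply: eq_op_from => -[//|i] le_im.
by rewrite /= (nth_map 0%N) ?size_iota // nth_iota.
Qed.

Theorem theorem1 (R : realType) (n N : nat) (n_ge3 : (3 <= n)%N)
    (A1 : vectType R[i]) (dimA1 : \dim {:A1} = N)
    (Gamma : {ffun 'I_(n - 1) -> A1} -> A1) (Gamma_lin : multilinear Gamma)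
    (q1 : {symmetric A1}) (q1_nondeg : form_nondegenerate q1)
    (Gamma_inv : form_invariant Gamma q1)
    (Gamma_assoc : generally_associative Gamma) :
  exists (A : lmodType R[i]) (mul : {bilinear A -> A -> A})
         (A_ : 'I_(n - 2) -> {pred A}) (q : {symmetric A})
         (iota : {linear A1 -> A}),
    (associative mul /\ graded mul A_ /\ metrised mul q) /\
    (* iota identifies A1 with the component of degree 1 *)
    (injective iota /\
     forall i : 'I_(n - 2), i = 1 %[mod n - 2] ->
       forall x : A, x \in A_ i <-> exists a : A1, x = iota a) /\
    (forall a b : A1, q (iota a) (iota b) = q1 a b) /\
    (forall i j : 'I_(n - 2), i + j <> 2 %[mod n - 2] ->
       forall x y : A, x \in A_ i -> y \in A_ j -> q x y = 0) /\
    (forall a : nat -> A1,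
       iota (op_from Gamma 0 a) = product mul (fun i => iota (a i)) (n - 2)).
Proof.
(* With [n] written as [m.+3], the arity and the modulus are convertible to [m.+2] and [m.+1]. *)
case: n n_ge3 Gamma Gamma_lin Gamma_inv Gamma_assoc => [|[|[|m]]] // _.
move=> Gamma Gamma_lin Gamma_inv Gamma_assoc.
apply: (@enveloping_algebra _ _ m.+1 Gamma q1) => // a.
  exact: (Gamma_inv a).1.
exact: Gamma_assoc.
Qed.
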